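(* Consider the quadratic-bilinear (QB) system given by the real matrices $A,N_1,\dots,N_m\in\mathbb{R}^{n\times n}$, $H\in\mathbb{R}^{n\times n^2}$ (symmetric as a Hessian), $B\in\mathbb{R}^{n\times m}$, $C\in\mathbb{R}^{p\times n}$, with $A$ stable. Let $P$ be the reachability Gramian and $Q=\sum_{i=1}^\infty Q_i$ the observability Gramian of the system, and assume that they exist. Then $Q$ satisfies the Lyapunov equation $$A^TQ+QA+\mathcal{H}^{(2)}(P\otimes Q)(\mathcal{H}^{(2)})^T+\sum_{k=1}^m N_k^TQN_k+C^TC=0 .$$
   Context: The QB system is $\dot x(t)=Ax(t)+H(x(t)\otimes x(t))+\sum_{k=1}^m N_kx(t)u_k(t)+Bu(t)$, $y(t)=Cx(t)$, $x(0)=0$; $\otimes$ is the Kronecker product. A matrix is stable if all its eigenvalues have negative real part. $H$ is symmetric, i.e. $H(u\otimes v)=H(v\otimes u)$ for all $u,v\in\mathbb{R}^n$. Matricization: let $\mathcal{H}=(h_{ijk})\in\mathbb{R}^{n\times n\times n}$ be the tensor whose mode-1 matricization is $H$, i.e. $H_{i,(k-1)n+j}=h_{ijk}$. Its mode-2 matricization is the matrix $\mathcal{H}^{(2)}\in\mathbb{R}^{n\times n^2}$ with $\mathcal{H}^{(2)}_{j,(k-1)n+i}=h_{ijk}$; equivalently $\mathcal{H}^{(2)}(x\otimes z)=(x^T\otimes I_n)H^Tz$ for all $x,z\in\mathbb{R}^n$. Square brackets with commas denote horizontal concatenation. Define $\bar P_1(t_1)=e^{At_1}B$, $\bar P_2(t_1,t_2)=e^{At_2}[N_1,\dots,N_m](I_m\otimes\bar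 P_1(t_1))$, and for $i\ge3$ $$\bar P_i(t_1,\dots,t_i)=e^{At_i}\Big[H\big[\bar P_1(t_1)\otimes\bar P_{i-2}(t_2,\dots,t_{i-1}),\ \bar P_2(t_1,t_2)\otimes\bar P_{i-3}(t_3,\dots,t_{i-1}),\dots,\bar P_{i-2}(t_1,\dots,t_{i-2})\otimes\bar P_1(t_{i-1})\big],\ [N_1,\dots,N_m](I_m\otimes\bar P_{i-1}(t_1,\dots,t_{i-1}))\Big].$$ Reachability Gramian: $P=\sum_{i\ge1}P_i$, $P_i=\int_0^\infty\cdots\int_0^\infty\bar P_i\bar P_i^T\,dt_1\cdots dt_i$; it satisfies $AP+PA^T+H(P\otimes P)H^T+\sum_{k=1}^mN_kPN_k^T+BB^T=0$. Define $\bar Q_1(t_1)=e^{A^Tt_1}C^T$, $\bar Q_2(t_1,t_2)=e^{A^Tt_2}[N_1^T,\dots,N_m^T](I_m\otimes\bar Q_1(t_1))$, and for $i\ge3$ $$\bar Q_i(t_1,\dots,t_i)=e^{A^Tt_i}\Big[\mathcal{H}^{(2)}\big[\bar P_1(t_1)\otimes\bar Q_{i-2}(t_2,\dots,t_{i-1}),\ \bar P_2(t_1,t_2)\otimes\bar Q_{i-3}(t_3,\dots,t_{i-1}),\dots,\bar P_{i-2}(t_1,\dots,t_{i-2})\otimes\bar Q_1(t_{i-1})\big],\ [N_1^T,\dots,N_m^T](I_m\otimes\bar Q_{i-1}(t_1,\dots,t_{i-1}))\Big].$$ Observability Gramian: $Q=\sum_{i\ge1}Q_i$, $Q_i=\int_0^\infty\cdots\int_0^\infty\bar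 Q_i\bar Q_i^T\,dt_1\cdots dt_i$. A Gramian exists if its defining series of integrals converges. *)

(* Defs.v *)
From mathcomp Require Export all_boot all_order all_algebra.
From mathcomp Require Export mxtens.
From mathcomp Require Import complex.
From mathcomp Require Import zify.
From mathcomp Require Export all_classical all_reals all_analysis.
Export numFieldNormedType.Exports.
Set Implicit Arguments.
Unset Strict Implicit.
Unset Printing Implicit Defensive.
Export Order.TTheory GRing.Theory Num.Theory.
Local Open Scope classical_set_scope.
Local Open Scope ring_scope.

(* The Kronecker product is mxtens's [A *t B]; its row and column positions are
   given (from 0) by the value i * n + j of [mxtens_index (i, j)]. *)

Section MatrixNotions.
Context {R : realType}.

Definition stable n (A : 'M[R]_n) : Prop :=
  forall z : R[i], eigenvalue (map_mx (real_complex R) A) z -> complex.Re z < 0.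

Definition expmx n (A : 'M[R]_n) : 'M[R]_n :=
  limn (series (fun k : nat => (k`!%:R^-1 : R) *: A ^+ k)).

(* The tensor (h_ijk) whose mode-1 matricization is H. *)
Definition tensor n (H : 'M[R]_(n, n * n)) (i j k : 'I_n) : R :=
  H i (mxtens_index (k, j)).

Definition mode2 n (H : 'M[R]_(n, n * n)) : 'M[R]_(n, n * n) :=
  \matrix_(j, l) tensor H (mxtens_unindex l).2 j (mxtens_unindex l).1.

Definition hessian_symmetric n (H : 'M[R]_(n, n * n)) : Prop :=
  forall u v : 'cV[R]_n, H *m (u *t v) = H *m (v *t u).

(* The block row [N_1, ..., N_m]. *)
Definition blockrow m n (N : 'I_m -> 'M[R]_n) : 'M[R]_(n, m * n) :=
  \matrix_(i, l) N (mxtens_unindex l).1 i (mxtens_unindex l).2.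

(* mode2 H (x (x) z) = (x^T (x) I) H^T z, the row count 1 * n being read as n. *)
Lemma mode2_tensE n (H : 'M[R]_(n, n * n)) (x z : 'cV[R]_n) (a : 'I_n) :
  (mode2 H *m (x *t z)) a 0 =
  ((x^T *t (1%:M : 'M[R]_n)) *m (H^T *m z)) (mxtens_index (0 : 'I_1, a)) 0.
Proof.
have bij : {on [pred _ | true], bijective (@mxtens_index n n)}.
  by exists (@mxtens_unindex n n) => l _; rewrite ?mxtens_indexK ?mxtens_unindexK.
rewrite mxE [RHS]mxE (reindex _ bij) [RHS](reindex _ bij) /=.
transitivity (\sum_k \sum_i tensor H i a k * (x k 0 * z i 0)).
  rewrite pair_bigA /=; apply: eq_bigr => -[k i] _ /=.
  by rewrite !mxE mxtens_indexK /= !ord1.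
transitivity (\sum_k \sum_j (x^T *t (1%:M : 'M[R]_n)) (mxtens_index (0 : 'I_1, a))
    (mxtens_index (k, j)) * (H^T *m z) (mxtens_index (k, j)) 0); last first.
  by rewrite pair_bigA /=; apply: eq_bigr => -[].
apply: eq_bigr => k _; rewrite [RHS](bigD1 a) //= [X in _ + X]big1 => [|j ja]; last first.
  by rewrite mxE !mxtens_indexK /= !mxE eq_sym (negPf ja) mulr0 mul0r.
rewrite addr0 mxE !mxtens_indexK /= !mxE eqxx mulr1 mulr_sumr.
by apply: eq_bigr => i _; rewrite !mxE /tensor mulrCA.
Qed.

End MatrixNotions.

(* The number of columns of \bar P_i depends on i; such matrices are packed with
   their number of columns. *)
Section ColumnBlocks.
Context {R : realType}.

Definition colmx (r : nat) : Type := {c : nat & 'M[R]_(r, c)}.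

Definition nocol {r} : colmx r := existT _ 0%N (0 : 'M[R]_(r, 0)).

Definition hcat r (X Y : colmx r) : colmx r :=
  existT _ _ (row_mx (tagged X) (tagged Y)).

Definition lmulc q r (M : 'M[R]_(q, r)) (X : colmx r) : colmx q :=
  existT _ _ (M *m tagged X).

Definition tensc q r (X : colmx q) (Y : colmx r) : colmx (q * r) :=
  existT _ _ (tagged X *t tagged Y).

Definition gram r (X : colmx r) : 'M[R]_r := tagged X *m (tagged X)^T.

End ColumnBlocks.
Arguments colmx R r : clear implicits.

(* [K i t] stands for K_i(t_1, ..., t_i), with t = [:: t_1; ...; t_i], i >= 1. *)
Definition kernels (R : realType) (n : nat) : Type := nat -> seq R -> colmx R n.

Section Gramians.
Context {R : realType} (n m : nat).

Definition bilin (N : 'I_m -> 'M[R]_n) (X : colmx R n) : colmx R n :=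
  lmulc (blockrow N) (tensc (existT _ m (1%:M : 'M[R]_m)) X).

(* The common form of the two recurrences; L is the family of the left Kronecker
   factors. Only L_j and K_j with 1 <= j < i occur. *)
Definition kernel_step q (A : 'M[R]_n) (H : 'M[R]_(n, n * n))
    (N : 'I_m -> 'M[R]_n) (B : 'M[R]_(n, q)) (L K : kernels R n) : kernels R n :=
  fun i t =>
  lmulc (expmx (t`_i.-1 *: A))
    (match i with
     | 0 | 1 => existT _ q B
     | 2 => bilin N (K 1%N (take 1 t))
     | _ => hcat
         (lmulc H (\big[@hcat R (n * n)/nocol]_(1 <= j < i.-1)
            tensc (L j (take j t)) (K (i.-1 - j)%N (drop j (take i.-1 t)))))
         (bilin N (K i.-1 (take i.-1 t)))
     end).

(* After i iterations, the kernels of index 1, ..., i have their final value. *)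
Definition Pbar (A : 'M[R]_n) (H : 'M[R]_(n, n * n)) (N : 'I_m -> 'M[R]_n)
    (B : 'M[R]_(n, m)) : kernels R n :=
  fun i => iter i (fun K => kernel_step A H N B K K) (fun _ _ => nocol) i.

Definition Qbar p (A : 'M[R]_n) (H : 'M[R]_(n, n * n)) (N : 'I_m -> 'M[R]_n)
    (B : 'M[R]_(n, m)) (C : 'M[R]_(p, n)) : kernels R n :=
  fun i => iter i (kernel_step A^T (mode2 H) (fun k => (N k)^T) C^T
                     (Pbar A H N B)) (fun _ _ => nocol) i.

Lemma kernel_step_eq q A H N (B : 'M[R]_(n, q)) (L K L' K' : kernels R n) i :
  (forall j, (0 < j < i)%N -> L j = L' j) ->
  (forall j, (0 < j < i)%N -> K j = K' j) ->
  kernel_step A H N B L K i = kernel_step A H N B L' K' i.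
Proof.
move=> eL eK; apply/funext => t; rewrite /kernel_step; congr lmulc.
case: i eL eK => [//|[//|[|i]]] eL eK; first by rewrite eK.
congr hcat; last by rewrite eK //= leqnn.
congr lmulc; apply: eq_big_nat => j /andP[j0 /= ji].
by rewrite eL ?eK //; lia.
Qed.

Lemma PbarE A H N B i : (0 < i)%N ->
  Pbar A H N B i = kernel_step A H N B (Pbar A H N B) (Pbar A H N B) i.
Proof.
pose S := fun K : kernels R n => kernel_step A H N B K K.
have E k : forall j, (0 < j <= k)%N ->
    iter k S (fun _ _ => nocol) j = Pbar A H N B j.
  elim/ltn_ind: k => -[|k] IH j jk; first by lia.
  case: j jk => [//|j] /= jk; rewrite /Pbar /=.
  by apply: kernel_step_eq => l lj; rewrite !IH //; lia.
case: i => // i _; rewrite /Pbar /=.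
by apply: kernel_step_eq => j ji; apply: E; lia.
Qed.

Lemma QbarE p A H N B (C : 'M[R]_(p, n)) i : (0 < i)%N ->
  Qbar A H N B C i = kernel_step A^T (mode2 H) (fun k => (N k)^T) C^T
                       (Pbar A H N B) (Qbar A H N B C) i.
Proof.
pose S := kernel_step A^T (mode2 H) (fun k => (N k)^T) C^T (Pbar A H N B).
have E k : forall j, (0 < j <= k)%N ->
    iter k S (fun _ _ => nocol) j = Qbar A H N B C j.
  elim/ltn_ind: k => -[|k] IH j jk; first by lia.
  case: j jk => [//|j] /= jk; rewrite /Qbar /=.
  by apply: kernel_step_eq => l lj //; rewrite !IH //; lia.
case: i => // i _; rewrite /Qbar /=.
by apply: kernel_step_eq => j ji //; apply: E; lia.
Qed.

(* The iterated integral over [0, +oo[ of F(t_1, ..., t_i), taken entrywise,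
   t_1 being the innermost variable. *)
Fixpoint iterated_integral (i : nat) (F : seq R -> 'M[R]_n) : 'M[R]_n :=
  if i is k.+1 then
    \matrix_(a, b) \int[lebesgue_measure]_(s in `[0, +oo[)
      (iterated_integral k (fun t => F (rcons t s)) a b)
  else F [::].

(* [iterated_integral] has a default value where a Lebesgue integral diverges;
   this predicate excludes it at each level. *)
Fixpoint iterated_integrable (i : nat) (F : seq R -> 'M[R]_n) : Prop :=
  if i is k.+1 then
    (forall s, 0 <= s -> iterated_integrable k (fun t => F (rcons t s))) /\
    (forall a b, lebesgue_measure.-integrable `[0, +oo[
      (fun s => (iterated_integral k (fun t => F (rcons t s)) a b)%:E))
  else True.

Definition gramian_term (K : kernels R n) (i : nat) : 'M[R]_n :=
  iterated_integral i (fun t => gram (K i t)).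

Definition gramian (K : kernels R n) : 'M[R]_n :=
  limn (series (fun i => gramian_term K i.+1)).

Definition gramian_exists (K : kernels R n) : Prop :=
  (forall i, (0 < i)%N -> iterated_integrable i (fun t => gram (K i t))) /\
  cvgn (series (fun i => gramian_term K i.+1)).

End Gramians.

(* Main.v *)
From HB Require Import structures.
Require Import Defs.
From mathcomp Require Import measurable_realfun ring lra zify.
Set Implicit Arguments.
Unset Strict Implicit.
Unset Printing Implicit Defensive.

Local Open Scope classical_set_scope.
Local Open Scope ring_scope.

(* The last variable s = t_i enters \bar Q_i only through e^{A^T s}, so the
   Gramian term Q_i is the integral over [0, +oo[ of F(s) = e^{A^T s} M e^{A s},
   where M is the integral of the bracket over t_1, ..., t_{i-1}. As
   F' = A^T F + F A, and as an integrable F with integrable derivative tends to 0,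
   A^T Q_i + Q_i A + M = 0. Integrating the bracket block by block expresses M by
   the P_j and by the Q_j with j < i, in the form of a Cauchy product for the
   quadratic part. Since the P_j and the Q_j are positive semidefinite, their
   series converge absolutely entrywise, and summing over i gives the equation. *)

Section HalfLine.
Context {R : realType}.
Local Notation mu := (@lebesgue_measure R).

Lemma cvg_Rintegral0y (f : R -> R) (u : R^nat) :
  mu.-integrable `[0, +oo[ (EFin \o f) ->
  u n @[n --> \oo] --> +oo ->
  (\int[mu]_(x in `[0, u n]) f x) @[n --> \oo] -->
    \int[mu]_(x in `[0, +oo[) f x.
Proof.
move=> If uy.
have mf : measurable_fun `[(0 : R), +oo[ f.
  by apply/measurable_EFinP; exact: measurable_int If.
have E n : \int[mu]_(x in `[0, u n]) f x =
    \int[mu]_(x in `[0, +oo[) (f \_ `[0, u n]) x.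
  rewrite -Rintegral_mkcondr; congr Rintegral.
  by rewrite setIidr //; exact: subset_itvl.
under eq_cvg do rewrite E.
apply: fine_cvg; rewrite fineK; last exact: integrable_fin_num.
have [] := @dominated_convergence _ _ _ mu (`[(0 : R), +oo[%classic) (measurable_itv _)
  (fun n x => ((f \_ `[0, u n]) x)%:E) (EFin \o f) (EFin \o (fun x => `|f x|)) => //.
- move=> n; apply/measurable_EFinP; apply/measurable_restrict => //.
  by apply: measurable_funS mf => //; exact: subIsetr.
- exact/measurable_EFinP.
- apply: aeW => x x0; apply: cvg_EFin; first exact: nearW.
  apply: cvg_near_cst; near=> n.
  rewrite /= patchE mem_set //= in_itv /=; move: x0; rewrite /= in_itv/= andbT => ->/=.
  by near: n; apply: (cvgryPge _).1 => //.
- exact: integrable_norm.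
- apply: aeW => x n _; rewrite lee_fin patchE; case: ifP => // _.
  by rewrite normr0.
Unshelve. all: by end_near. Qed.

Lemma cvgy_integrable_eq0 (F : R -> R) (l : R) :
  F x @[x --> +oo] --> l ->
  mu.-integrable `[0, +oo[ (EFin \o F) -> l = 0.
Proof.
move=> Fl IF; apply/eqP/negPn/negP => l0.
have l2 : 0 < `|l| / 2 by rewrite divr_gt0 ?normr_gt0.
have [M [_ FM]] : \forall x \near +oo, `|l| / 2 <= `|F x|.
  have /cvgr_norm_ge : F x @[x --> +oo] --> l by [].
  by apply; rewrite ltr_pdivrMr // mulr_natr mulr2n ltrDl normr_gt0.
pose a := Num.max 0 (M + 1).
have a0 : 0 <= a by rewrite le_max lexx.
have aM x : a <= x -> `|l| / 2 <= `|F x|.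
  by move=> ax; apply: FM; apply: lt_le_trans ax; rewrite lt_max ltrDl ltr01 orbT.
have IFa : mu.-integrable `[a, +oo[ (EFin \o F).
  by apply: integrableS IF => //; apply: subset_itvr; rewrite bnd_simp.
have : mu.-integrable `[a, +oo[ (EFin \o cst (`|l| / 2)).
  apply: le_integrable IFa => //; first exact/measurable_EFinP.
  move=> x /=; rewrite in_itv /= andbT => /aM; rewrite lee_fin.
  by rewrite (ger0_norm (ltW l2)).
move=> /integrableP[_].
under eq_integral do rewrite /= (ger0_norm (ltW l2)).
rewrite integral_cst //= lebesgue_measure_itv /= ltry.
by rewrite gt0_muley ?ltxx // lte_fin.
Qed.

Lemma is_derive_continuous (F f : R -> R) :
  (forall x : R, is_derive x (1 : R) F (f x)) -> continuous F.
Proof.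
move=> dF x; apply: differentiable_continuous; apply/derivable1_diffP.
by case: (dF x).
Qed.

Lemma Rintegral_derive0y (F f : R -> R) :
  (forall x : R, is_derive x (1 : R) F (f x)) -> continuous f ->
  mu.-integrable `[0, +oo[ (EFin \o F) ->
  mu.-integrable `[0, +oo[ (EFin \o f) ->
  \int[mu]_(x in `[0, +oo[) f x = - F 0.
Proof.
move=> dF cf IF If; set I := Rintegral _ _ _.
have cF : continuous F := is_derive_continuous dF.
have FE x : 0 < x -> \int[mu]_(t in `[0, x]) f t = F x - F 0.
  move=> x0; rewrite /Rintegral (@continuous_FTC2 _ f F) //.
  - exact: continuous_subspaceT.
  - split; first by move=> y _; case: (dF y).
      by apply: cvg_at_right_filter; exact: cF.
    by apply: cvg_at_left_filter; exact: cF.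
  - by move=> y _; rewrite derive1E; case: (dF y).
have Fl : F x @[x --> +oo] --> I + F 0.
  apply/cvg_pinftyP => u uy.
  apply: cvg_trans (cvgD (cvg_Rintegral0y If uy) (cvg_cst (F 0))).
  apply: near_eq_cvg; near=> n.
  rewrite fctE FE ?subrK //; near: n.
  by apply: (cvgryPgt _).1.
by apply/eqP; rewrite -addr_eq0; apply/eqP; exact: cvgy_integrable_eq0 Fl IF.
Unshelve. all: by end_near. Qed.

End HalfLine.

Section MatrixExponential.
Context {R : realType}.

Lemma cvgn_mx m n (U : nat -> 'M[R]_(m, n)) (X : 'M[R]_(m, n)) :
  (forall i j, U k i j @[k --> \oo] --> X i j) -> U k @[k --> \oo] --> X.
Proof.
move=> UX; apply/cvg_ballP => e e0.
have : \forall k \near \oo, forall ij : 'I_m * 'I_n,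
    ball (X ij.1 ij.2) e (U k ij.1 ij.2).
  by apply: filter_forall => -[i j]; apply: (cvg_ballP _ _).1.
by apply: filterS => k Uk; split=> // i j; exact: (Uk (i, j)).
Qed.

Lemma cvgn_coord m n (U : nat -> 'M[R]_(m, n)) (X : 'M[R]_(m, n)) i j :
  U k @[k --> \oo] --> X -> U k i j @[k --> \oo] --> X i j.
Proof.
move=> UX; apply: (cvg_comp U (fun M : 'M[R]_(m, n) => M i j) UX).
exact: coord_continuous.
Qed.

Variable n : nat.
Implicit Types A M : 'M[R]_n.

Lemma norm_exprmx A k i j : `|(A ^+ k) i j| <= (\sum_a \sum_b `|A a b|) ^+ k.
Proof.
set S := \sum_a _.
have S0 : 0 <= S by do 2 (apply: sumr_ge0 => ? _).
elim: k i j => [|k IH] i j.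
  by rewrite !expr0 mxE; case: eqP; rewrite ?normr1 ?normr0.
rewrite exprS mxE (le_trans (ler_norm_sum _ _ _)) //.
apply: (@le_trans _ _ (\sum_c `|A i c| * S ^+ k)).
  by apply: ler_sum => c _; rewrite normrM ler_wpM2l.
rewrite -mulr_suml exprS ler_wpM2r ?exprn_ge0 // /S [leRHS](bigD1 i) //= lerDl.
by do 2 (apply: sumr_ge0 => ? _).
Qed.

(* The entry (a, b) of M e^{xA} as a power series in x. *)
Definition expmx_coef M A a b (k : nat) : R := k`!%:R^-1 * (M *m A ^+ k) a b.

Lemma pseries_diffs_expmx M A a b :
  pseries_diffs (expmx_coef M A a b) = expmx_coef (M *m A) A a b.
Proof.
apply/funext => k; rewrite /pseries_diffs /expmx_coef factS natrM invfM.
by rewrite exprS mulmxA mulrA mulVKf.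
Qed.

Lemma is_cvg_pseries_expmx M A a b x : cvgn (pseries (expmx_coef M A a b) x).
Proof.
pose S := \sum_a \sum_b `|A a b|; pose K := \sum_c `|M a c|.
apply: normed_cvg.
have cE : cvgn (series (fun k => K * exp_coeff (S * `|x|) k)).
  by apply: is_cvg_seriesZ; exact: is_cvg_series_exp_coeff.
apply: series_le_cvg cE => [k|k|k]; first exact: normr_ge0.
  rewrite /= mulr_ge0 ?sumr_ge0 // exp_coeff_ge0 // mulr_ge0 //.
  by do 2 (apply: sumr_ge0 => ? _).
have MA : `|(M *m A ^+ k) a b| <= K * S ^+ k.
  rewrite mxE (le_trans (ler_norm_sum _ _ _)) // mulr_suml.
  by apply: ler_sum => c _; rewrite normrM ler_wpM2l // norm_exprmx.
rewrite /expmx_coef /exp_coeff /= !normrM normrX normfV normr_nat.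
have -> : K * ((S * `|x|) ^+ k / k`!%:R) = k`!%:R^-1 * (K * S ^+ k) * `|x| ^+ k.
  by rewrite exprMn; ring.
by rewrite ler_wpM2r ?exprn_ge0 // ler_wpM2l ?invr_ge0.
Qed.

Lemma expr_scalemx x A k : (x *: A) ^+ k = x ^+ k *: A ^+ k.
Proof.
elim: k => [|k IH]; first by rewrite !expr0 scale1r.
rewrite !exprS IH -[LHS]/((x *: A) *m (x ^+ k *: A ^+ k)).
by rewrite -scalemxAl -scalemxAr scalerA.
Qed.

Lemma expmxE A x a b :
  expmx (x *: A) a b = limn (pseries (expmx_coef 1%:M A a b) x).
Proof.
have E i j : (fun k => series (fun k => k`!%:R^-1 *: (x *: A) ^+ k) k i j) =
    pseries (expmx_coef 1%:M A i j) x.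
  apply/funext => k; rewrite /pseries /series /= summxE; apply: eq_bigr => l _.
  by rewrite /expmx_coef expr_scalemx mul1mx !mxE; ring.
have cv : series (fun k => k`!%:R^-1 *: (x *: A) ^+ k) k @[k --> \oo] -->
    \matrix_(i, j) limn (pseries (expmx_coef 1%:M A i j) x).
  by apply: cvgn_mx => i j; rewrite E mxE; exact: is_cvg_pseries_expmx.
by rewrite /expmx (cvg_lim _ cv) ?mxE //; exact: norm_hausdorff.
Qed.

Lemma mulmx_expmxE M A x a b :
  (M *m expmx (x *: A)) a b = limn (pseries (expmx_coef M A a b) x).
Proof.
apply/esym/cvg_lim => //.
have E : pseries (expmx_coef M A a b) x =
    fun k => \sum_c M a c * pseries (expmx_coef 1%:M A c b) x k.
  apply/funext => k; rewrite /pseries /series /=.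
  under [RHS]eq_bigr do rewrite mulr_sumr.
  rewrite exchange_big; apply: eq_bigr => l _ /=.
  rewrite /expmx_coef mxE mulr_sumr mulr_suml; apply: eq_bigr => c _.
  by rewrite mul1mx; ring.
rewrite E mxE; apply: cvg_big => [|c _]; first exact: add_continuous.
apply: cvgMr.
by rewrite expmxE; exact: is_cvg_pseries_expmx.
Qed.

Lemma is_derive_expmx A x a b :
  is_derive x (1 : R) (fun y => expmx (y *: A) a b) ((A *m expmx (x *: A)) a b).
Proof.
have -> : (fun y => expmx (y *: A) a b) =
    fun y => limn (pseries (expmx_coef 1%:M A a b) y).
  by apply/funext => y; rewrite expmxE.
rewrite mulmx_expmxE.
have -> : expmx_coef A A a b = pseries_diffs (expmx_coef 1%:M A a b).
  by rewrite pseries_diffs_expmx mul1mx.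
apply: (@pseries_snd_diffs _ _ (`|x| + 1)); rewrite ?pseries_diffs_expmx.
1-3: exact: is_cvg_pseries_expmx.
by rewrite [ltRHS]ger0_norm ?ltrDl // addr_ge0.
Qed.

Lemma expmx0 A : expmx (0 *: A) = 1%:M.
Proof.
apply/matrixP => a b; rewrite expmxE; apply: cvg_lim => //.
rewrite -cvg_shiftS; apply: cvg_near_cst; apply: nearW => k.
rewrite /pseries /series /= big_nat_recl //= big1 => [|i _].
  by rewrite /expmx_coef !expr0 fact0 invr1 mul1mx mul1r mulr1 addr0.
by rewrite expr0n mulr0.
Qed.

End MatrixExponential.

Section IteratedIntegrals.
Context {R : realType}.
Local Notation mu := (@lebesgue_measure R).
Local Notation halfline := (`[(0 : R), +oo[%classic : set R).

Lemma integrable_lincomb (I : Type) (r : seq I) (g : I -> R) (h : I -> R -> R) :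
  (forall i, mu.-integrable halfline (EFin \o h i)) ->
  mu.-integrable halfline (EFin \o (fun s => \sum_(i <- r) g i * h i s)).
Proof.
move=> Ih.
have I1 : mu.-integrable halfline (fun s => \sum_(i <- r) (g i)%:E * (h i s)%:E)%E.
  by apply: integrable_sum => // i _; apply: integrableZl => //; exact: Ih.
apply: eq_integrable I1 => // s _ /=.
by rewrite -sumEFin; apply: eq_bigr => i _; rewrite EFinM.
Qed.

Lemma Rintegral_lincomb (I : Type) (r : seq I) (g : I -> R) (h : I -> R -> R) :
  (forall i, mu.-integrable halfline (EFin \o h i)) ->
  \int[mu]_(s in halfline) (\sum_(i <- r) g i * h i s) =
  \sum_(i <- r) g i * \int[mu]_(s in halfline) h i s.
Proof.
move=> Ih; elim: r => [|i r IH].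
  rewrite big_nil; under eq_Rintegral do rewrite big_nil.
  by rewrite Rintegral_cst // mul0r.
rewrite big_cons -IH -RintegralZl // -RintegralD //; last 2 first.
- have /= := @integrable_lincomb _ [:: i] g h Ih.
  by under [X in _ \o X]eq_fun do rewrite big_seq1.
- exact: integrable_lincomb.
by apply: eq_Rintegral => s _; rewrite big_cons.
Qed.

Definition has_iterated_integral n k (F : seq R -> 'M[R]_n) (X : 'M[R]_n) :=
  iterated_integrable k F /\ iterated_integral k F = X.

Lemma has_iterated_integralSP n k (F : seq R -> 'M[R]_n) X :
  has_iterated_integral k.+1 F X <->
  exists Y : R -> 'M[R]_n,
    (forall s, 0 <= s -> has_iterated_integral k (fun t => F (rcons t s)) (Y s)) /\
    forall a b, mu.-integrable halfline (EFin \o (fun s => Y s a b)) /\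
      \int[mu]_(s in halfline) Y s a b = X a b.
Proof.
split=> [[[/= IFk IF] <-]|[Y [FY YX]]].
  exists (fun s => iterated_integral k (fun t => F (rcons t s))).
  split=> [s s0|a b]; first by split=> //; exact: IFk.
  by split; [exact: IF|rewrite mxE].
have E a b s : s \in halfline ->
    Y s a b = iterated_integral k (fun t => F (rcons t s)) a b.
  by rewrite inE /= in_itv /= andbT => /FY[_ ->].
split=> /=.
  split=> [s /FY[]//|a b]; have [IY _] := YX a b.
  by apply: eq_integrable IY => // s s0 /=; rewrite E.
by apply/matrixP => a b; rewrite mxE -(YX a b).2; apply/esym/eq_Rintegral => s /E.
Qed.

Lemma eq_has_iterated_integral n k (F G : seq R -> 'M[R]_n) X :
  (forall t, size t = k -> F t = G t) ->
  has_iterated_integral k F X -> has_iterated_integral k G X.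
Proof.
elim: k F G X => [|k IH] F G X FG; first by case=> _ <-; split=> //=; rewrite FG.
move=> /has_iterated_integralSP[Y [FY YX]].
apply/has_iterated_integralSP; exists Y; split=> // s s0.
by apply: IH (FY _ s0) => t tk; apply: FG; rewrite size_rcons tk.
Qed.

Lemma linear_mxE n q (L : 'M[R]_n -> 'M[R]_q) Y c d : linear L ->
  L Y c d = \sum_(ij : 'I_n * 'I_n) L (delta_mx ij.1 ij.2) c d * Y ij.1 ij.2.
Proof.
move=> linL; pose Lm : {linear 'M[R]_n -> 'M[R]_q} :=
  HB.pack L (GRing.isLinear.Build _ _ _ _ L linL).
rewrite -[L]/(Lm : _ -> _) {1}[Y]matrix_sum_delta pair_bigA linear_sum summxE.
by apply: eq_bigr => ij _; rewrite linearZ mxE mulrC.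
Qed.

Lemma has_iterated_integral_linear n q k (L : 'M[R]_n -> 'M[R]_q)
    (F : seq R -> 'M[R]_n) X :
  linear L -> has_iterated_integral k F X ->
  has_iterated_integral k (fun t => L (F t)) (L X).
Proof.
move=> linL.
elim: k F X => [|k IH] F X; first by case=> _ <-.
move=> /has_iterated_integralSP[Y [FY YX]]; apply/has_iterated_integralSP.
exists (fun s => L (Y s)); split=> [s s0|c d]; first exact: IH (FY _ s0).
have -> : (fun s => L (Y s) c d) = fun s =>
    \sum_(ij : 'I_n * 'I_n) L (delta_mx ij.1 ij.2) c d * Y s ij.1 ij.2.
  by apply/funext => s; exact: linear_mxE.
have IY (ij : 'I_n * 'I_n) : mu.-integrable halfline (EFin \o (fun s => Y s ij.1 ij.2)).
  by case: (YX ij.1 ij.2).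
split; first exact: integrable_lincomb.
rewrite Rintegral_lincomb // (linear_mxE _ _ _ linL).
by apply: eq_bigr => ij _; rewrite (YX _ _).2.
Qed.

Lemma has_iterated_integralD n k (F G : seq R -> 'M[R]_n) X Y :
  has_iterated_integral k F X -> has_iterated_integral k G Y ->
  has_iterated_integral k (fun t => F t + G t) (X + Y).
Proof.
elim: k F G X Y => [|k IH] F G X Y; first by move=> [_ <-] [_ <-].
move=> /has_iterated_integralSP[X' [FX XX]] /has_iterated_integralSP[Y' [GY YY]].
apply/has_iterated_integralSP; exists (fun s => X' s + Y' s).
split=> [s s0|a b]; first exact: IH (FX _ s0) (GY _ s0).
have [IX EX] := XX a b; have [IY EY] := YY a b.
have -> : (fun s => (X' s + Y' s) a b) = fun s => X' s a b + Y' s a b.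
  by apply/funext => s; rewrite mxE.
split; first by apply: eq_integrable (integrableD _ IX IY).
by rewrite RintegralD // EX EY mxE.
Qed.

Lemma has_iterated_integral0 n k : has_iterated_integral k (fun=> 0 : 'M[R]_n) 0.
Proof.
elim: k => [//|k IH]; apply/has_iterated_integralSP; exists (fun=> 0).
split=> // a b; split; last by rewrite Rintegral_cst // mxE mul0r.
have -> : (EFin \o fun=> (0 : 'M[R]_n) a b) = cst 0%E :> (R -> _).
  by apply/funext => s /=; rewrite mxE.
exact: integrable0.
Qed.

Lemma has_iterated_integral_sum n k (I : eqType) (r : seq I)
    (F : I -> seq R -> 'M[R]_n) X :
  {in r, forall i, has_iterated_integral k (F i) (X i)} ->
  has_iterated_integral k (fun t => \sum_(i <- r) F i t) (\sum_(i <- r) X i).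
Proof.
elim: r => [|i r IH] FX.
  rewrite big_nil; apply: eq_has_iterated_integral (has_iterated_integral0 _ _) => t _.
  by rewrite big_nil.
rewrite big_cons; apply: (@eq_has_iterated_integral _ _
  (fun t => F i t + \sum_(i <- r) F i t)) => [t _|]; first by rewrite big_cons.
apply: has_iterated_integralD; first by apply: FX; rewrite mem_head.
by apply: IH => j jr; apply: FX; rewrite inE jr orbT.
Qed.

Lemma mulmx_lr_linear m n q r (M : 'M[R]_(m, n)) (M' : 'M[R]_(q, r)) :
  linear (fun X : 'M[R]_(n, q) => M *m X *m M').
Proof. by move=> a X Y; rewrite mulmxDr mulmxDl -scalemxAr -scalemxAl. Qed.

Lemma lyapunov_linear n (A : 'M[R]_n) :
  linear (fun X : 'M[R]_n => A *m X + X *m A^T).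
Proof.
move=> a X Y; rewrite !mulmxDr !mulmxDl -scalemxAl -scalemxAr scalerDr.
exact: addrACA.
Qed.

Lemma tensmx_linearl n q (Y : 'M[R]_q) : linear (fun X : 'M[R]_n => X *t Y).
Proof. by move=> a X X'; apply/matrixP => i j; rewrite !mxE; ring. Qed.

Lemma tensmx_linearr n q (X : 'M[R]_n) : linear (fun Y : 'M[R]_q => X *t Y).
Proof. by move=> a Y Y'; apply/matrixP => i j; rewrite !mxE; ring. Qed.

(* No Fubini argument: the variables of F are the innermost ones. *)
Lemma has_iterated_integral_tens n q j k (F : seq R -> 'M[R]_n)
    (G : seq R -> 'M[R]_q) X Y :
  has_iterated_integral j F X -> has_iterated_integral k G Y ->
  has_iterated_integral (j + k) (fun t => F (take j t) *t G (drop j t)) (X *t Y).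
Proof.
move=> FX; elim: k G Y => [|k IH] G Y.
  rewrite addn0 => -[_ <-] /=.
  apply: eq_has_iterated_integral
    (has_iterated_integral_linear (@tensmx_linearl _ _ _) FX) => t tj.
  by rewrite -tj take_size drop_size.
move=> /has_iterated_integralSP[Z [GZ ZY]]; rewrite addnS.
apply/has_iterated_integralSP; exists (fun s => X *t Z s); split=> [s s0|a b].
  apply: eq_has_iterated_integral (IH _ _ (GZ _ s0)) => t tjk.
  by rewrite drop_rcons -?[rcons t s]cats1 ?takel_cat ?tjk ?leq_addr.
case: (mxtens_indexP a) => a1 a2; case: (mxtens_indexP b) => b1 b2.
have [IZ EZ] := ZY a2 b2.
have -> : (fun s => (X *t Z s) (mxtens_index (a1, a2)) (mxtens_index (b1, b2))) =
    fun s => X a1 b1 * Z s a2 b2.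
  by apply/funext => s; rewrite tensmxE.
split; last by rewrite RintegralZl // EZ tensmxE.
by apply: eq_integrable (integrableZl _ (X a1 b1) IZ).
Qed.

Lemma has_iterated_integral_ge0 k (F : seq R -> 'M[R]_1) X :
  (forall t, 0 <= F t 0 0) -> has_iterated_integral k F X -> 0 <= X 0 0.
Proof.
elim: k F X => [|k IH] F X F0; first by case=> _ <-; exact: F0.
move=> /has_iterated_integralSP[Y [FY YX]]; rewrite -(YX 0 0).2.
apply: Rintegral_ge0 => s; rewrite /= in_itv /= andbT => s0.
by apply: IH (FY _ s0).
Qed.

End IteratedIntegrals.

Section GramMatrices.
Context {R : realType}.

Lemma gram_lmulc q r (M : 'M[R]_(q, r)) (X : colmx R r) :
  gram (lmulc M X) = M *m gram X *m M^T.
Proof. by rewrite /gram /= trmx_mul !mulmxA. Qed.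

Lemma gram_hcat r (X Y : colmx R r) : gram (hcat X Y) = gram X + gram Y.
Proof. by rewrite /gram /= tr_row_mx mul_row_col. Qed.

Lemma gram_nocol r : gram (nocol : colmx R r) = 0.
Proof. by rewrite /gram /= mul0mx. Qed.

Lemma gram_tensc q r (X : colmx R q) (Y : colmx R r) :
  gram (tensc X Y) = gram X *t gram Y.
Proof. by rewrite /gram /= trmx_tens tensmx_mul. Qed.

Lemma sum_mxtens m n (f : 'I_(m * n) -> R) :
  \sum_l f l = \sum_k \sum_j f (mxtens_index (k, j)).
Proof.
rewrite pair_bigA (reindex (@mxtens_index m n)) /=; last first.
  by exists (@mxtens_unindex m n) => l _; rewrite ?mxtens_indexK ?mxtens_unindexK.
by apply: eq_bigr => -[].
Qed.

Lemma blockrow_mul_tens m n (N : 'I_m -> 'M[R]_n) (G : 'M[R]_n) :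
  blockrow N *m ((1%:M : 'M[R]_m) *t G) = blockrow (fun k => N k *m G).
Proof.
apply/matrixP => i l; case: (mxtens_indexP l) => k j.
rewrite mxE sum_mxtens [RHS]mxE mxtens_indexK [RHS]mxE (bigD1 k) //=.
rewrite [X in _ + X]big1 => [|k' k'k].
  rewrite addr0; apply: eq_bigr => j' _.
  by rewrite tensmxE !mxE mxtens_indexK /= eqxx mul1r.
rewrite big1 // => j' _.
by rewrite tensmxE !mxE mxtens_indexK /= (negPf k'k) mul0r mulr0.
Qed.

Lemma blockrow_mul_tr m n (M N : 'I_m -> 'M[R]_n) :
  blockrow M *m (blockrow N)^T = \sum_k M k *m (N k)^T.
Proof.
apply/matrixP => i i'; rewrite summxE mxE sum_mxtens; apply: eq_bigr => k _.
by rewrite mxE; apply: eq_bigr => j _; rewrite !mxE mxtens_indexK.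
Qed.

Lemma gram_bilin m n (N : 'I_m -> 'M[R]_n) (X : colmx R n) :
  gram (bilin N X) = \sum_k N k *m gram X *m (N k)^T.
Proof.
rewrite /bilin gram_lmulc gram_tensc {1}/gram /= trmx1 mulmx1.
by rewrite blockrow_mul_tens blockrow_mul_tr.
Qed.

Lemma gram_kernel_stepSS n m q (A : 'M[R]_n) H (N : 'I_m -> 'M[R]_n)
    (B : 'M[R]_(n, q)) (L K : kernels R n) i t :
  gram (kernel_step A H N B L K i.+2 t) =
  expmx (t`_i.+1 *: A) *m
    (H *m (\sum_(1 <= j < i.+1) gram (L j (take j (take i.+1 t))) *t
       gram (K (i.+1 - j)%N (drop j (take i.+1 t)))) *m H^T
     + \sum_k N k *m gram (K i.+1 (take i.+1 t)) *m (N k)^T)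
  *m (expmx (t`_i.+1 *: A))^T.
Proof.
rewrite /kernel_step gram_lmulc; congr (_ *m _ *m _); case: i => [|i].
  by rewrite big_geq // mulmx0 mul0mx add0r gram_bilin.
rewrite gram_hcat gram_bilin gram_lmulc; congr (_ *m _ *m _ + _).
rewrite (big_morph (@gram _ _) (@gram_hcat _) (@gram_nocol _)).
apply: eq_big_nat => j /andP[_ ji]; rewrite gram_tensc take_takel //.
exact: ltnW.
Qed.

End GramMatrices.

Section LyapunovStep.
Context {R : realType}.
Local Notation mu := (@lebesgue_measure R).
Local Notation halfline := (`[(0 : R), +oo[%classic : set R).

Lemma is_derive_mulmx q r s (U U' : R -> 'M[R]_(q, r))
    (V V' : R -> 'M[R]_(r, s)) (x : R) :
  (forall a b, is_derive x (1 : R) (fun y => U y a b) (U' x a b)) ->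
  (forall a b, is_derive x (1 : R) (fun y => V y a b) (V' x a b)) ->
  forall a b, is_derive x (1 : R) (fun y => (U y *m V y) a b)
    ((U' x *m V x + U x *m V' x) a b).
Proof.
move=> dU dV a b.
have -> : (fun y => (U y *m V y) a b) =
    \sum_(c < r) ((fun y => U y a c) * (fun y => V y c b)).
  by apply/funext => y; rewrite fct_sumE mxE.
apply: (is_derive_eq (is_derive_sum (fun c => is_deriveM (dU a c) (dV c b)))).
rewrite !mxE -big_split; apply: eq_bigr => c _ /=.
by rewrite addrC; congr (_ + _); exact: mulrC.
Qed.

Lemma is_derive_expmx_conj n (A M : 'M[R]_n) (x : R) a b :
  is_derive x (1 : R)
    (fun y => (expmx (y *: A) *m M *m (expmx (y *: A))^T) a b)
    ((A *m (expmx (x *: A) *m M *m (expmx (x *: A))^T)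
      + expmx (x *: A) *m M *m (expmx (x *: A))^T *m A^T) a b).
Proof.
pose E y := expmx (y *: A).
have dE y c d : is_derive y (1 : R) (fun y => E y c d) ((A *m E y) c d).
  exact: is_derive_expmx.
have dEM y c d : is_derive y (1 : R) (fun y => (E y *m M) c d) ((A *m E y *m M) c d).
  have := @is_derive_mulmx _ _ _ E (fun y => A *m E y) (fun=> M) (fun=> 0) y (dE y) _ c d.
  rewrite mulmx0 addr0; apply => i j; rewrite mxE; exact: is_derive_cst.
have dET y c d : is_derive y (1 : R) (fun y => (E y)^T c d) (((E y)^T *m A^T) c d).
  rewrite -trmx_mul mxE.
  by have -> : (fun y => (E y)^T c d) = fun y => E y d c by apply/funext => z; rewrite mxE.
have := @is_derive_mulmx _ _ _ (fun y => E y *m M) (fun y => A *m E y *m M)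
  (fun y => (E y)^T) (fun y => (E y)^T *m A^T) x (dEM x) (dET x) a b.
by rewrite /E !mulmxA.
Qed.

Lemma lyapunov_has_integral n (A M X : 'M[R]_n) :
  has_iterated_integral 1
    (fun t => expmx (t`_0 *: A) *m M *m (expmx (t`_0 *: A))^T) X ->
  A *m X + X *m A^T + M = 0.
Proof.
pose F x := expmx (x *: A) *m M *m (expmx (x *: A))^T.
pose L (Y : 'M[R]_n) := A *m Y + Y *m A^T.
have linL : linear L := lyapunov_linear A.
have I1 (G : R -> 'M[R]_n) Y : has_iterated_integral 1 (fun t => G t`_0) Y ->
    forall a b, mu.-integrable halfline (EFin \o (fun s => G s a b)) /\
      \int[mu]_(s in halfline) G s a b = Y a b.
  case=> [[_ IG] EG] a b; split; first exact: IG.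
  by rewrite -EG mxE.
move=> FX; have FI := I1 F X FX.
have DI := I1 (L \o F) (L X) (has_iterated_integral_linear linL FX).
have dF x a b : is_derive x (1 : R) (fun y => F y a b) (L (F x) a b).
  exact: is_derive_expmx_conj.
have cF a b : continuous (fun y => F y a b).
  by apply: is_derive_continuous => x; exact: dF.
apply/matrixP => a b.
have [IF _] := FI a b; have [ID ED] := DI a b.
have cD : continuous (fun y => (L \o F) y a b).
  have -> : (fun y => (L \o F) y a b) =
      fun y => \sum_c A a c * F y c b + \sum_c F y a c * A b c.
    apply/funext => y; rewrite /= /L !mxE; congr (_ + _).
    by apply: eq_bigr => c _; rewrite [A^T _ _]mxE.
  move=> x; apply: cvgD; (apply: cvg_big => [|c _]; first exact: add_continuous).
    by apply: cvgM; [exact: cvg_cst|exact: cF].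
  by apply: cvgM; [exact: cF|exact: cvg_cst].
have := Rintegral_derive0y (fun x => dF x a b) cD IF ID.
rewrite ED /F expmx0 mul1mx trmx1 mulmx1 /L => E.
by rewrite mxE E mxE addNr.
Qed.

Lemma lyapunov_step n k (A : 'M[R]_n) (G : seq R -> 'M[R]_n) M X :
  has_iterated_integral k G M ->
  has_iterated_integral k.+1
    (fun t => expmx (t`_k *: A) *m G (take k t) *m (expmx (t`_k *: A))^T) X ->
  A *m X + X *m A^T + M = 0.
Proof.
move=> GM /has_iterated_integralSP[Y [GY YX]].
apply: lyapunov_has_integral; apply/has_iterated_integralSP.
exists Y; split=> // s s0; split=> //=.
have [_ <-] := GY _ s0.
pose L (Z : 'M[R]_n) := expmx (s *: A) *m Z *m (expmx (s *: A))^T.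
have linL : linear L by exact: mulmx_lr_linear.
have := has_iterated_integral_linear linL GM.
move/(@eq_has_iterated_integral _ _ _ _
  (fun t => expmx ((rcons t s)`_k *: A) *m G (take k (rcons t s))
            *m (expmx ((rcons t s)`_k *: A))^T)) => H.
have [|_ ->//] := H _.
move=> t tk; rewrite nth_rcons tk ltnn eqxx -cats1 take_cat tk ltnn subnn.
by rewrite take0 cats0.
Qed.

Section Kernels.
Variables (n m q : nat) (A : 'M[R]_n) (H : 'M[R]_(n, n * n)) (N : 'I_m -> 'M[R]_n)
  (B : 'M[R]_(n, q)) (L K : kernels R n) (p k : nat -> 'M[R]_n).
Hypothesis KE : forall i, (0 < i)%N -> K i = kernel_step A H N B L K i.
Hypothesis Lp : forall i, has_iterated_integral i.+1 (fun t => gram (L i.+1 t)) (p i).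
Hypothesis Kk : forall i, has_iterated_integral i.+1 (fun t => gram (K i.+1 t)) (k i).

Lemma lyapunov_kernel1 : A *m k 0 + k 0 *m A^T + B *m B^T = 0.
Proof.
apply: (@lyapunov_step _ 0 _ (fun=> B *m B^T)) => //.
apply: eq_has_iterated_integral (Kk 0) => t _.
by rewrite KE // /kernel_step gram_lmulc.
Qed.

Lemma lyapunov_kernelSS i :
  A *m k i.+1 + k i.+1 *m A^T
  + (H *m (\sum_(l < i) p l *t k (i.-1 - l)%N) *m H^T
     + \sum_j N j *m k i *m (N j)^T) = 0.
Proof.
pose G t := H *m (\sum_(1 <= j < i.+1) gram (L j (take j t)) *t
       gram (K (i.+1 - j)%N (drop j t))) *m H^T
     + \sum_j N j *m gram (K i.+1 t) *m (N j)^T.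
apply: (@lyapunov_step _ i.+1 _ G); last first.
  apply: eq_has_iterated_integral (Kk i.+1) => t _.
  by rewrite KE // gram_kernel_stepSS.
apply: has_iterated_integralD.
  apply: (has_iterated_integral_linear (mulmx_lr_linear H H^T)).
  rewrite -(big_mkord xpredT (fun l => p l *t k (i.-1 - l)%N)).
  rewrite -(@big_add1 _ _ _ 0 i.+1 xpredT (fun l => p l.-1 *t k (i.-1 - l.-1)%N)).
  apply: has_iterated_integral_sum => j; rewrite mem_index_iota => /andP[j0 ji].
  have [l il] : exists l, i.+1 = (j + l.+1)%N by exists (i - j)%N; lia.
  have -> : (i.-1 - j.-1 = l)%N by lia.
  have -> : (i.+1 - j = l.+1)%N by lia.
  rewrite il; case: j j0 {ji il} => // j _.
  exact: (has_iterated_integral_tens (Lp j) (Kk l)).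
apply: has_iterated_integral_sum => j _.
exact: (has_iterated_integral_linear (mulmx_lr_linear (N j) (N j)^T)).
Qed.

End Kernels.
End LyapunovStep.

Section CauchyProduct.
Context {R : realType}.
Implicit Types a b : R^nat.

Definition cauchy_prod a b : R^nat :=
  fun i => \sum_(l < i.+1) a l * b (i - l)%N.

Lemma series_cauchy_prod a b k :
  series (cauchy_prod a b) k = \sum_(l < k) a l * series b (k - l)%N.
Proof.
elim: k => [|k IH]; first by rewrite /series /= big_geq // big_ord0.
rewrite seriesSr IH [RHS]big_ord_recr /= subSnn.
rewrite /cauchy_prod big_ord_recr /= subnn addrA -big_split /= seriesSr.
rewrite [series b 0%N]big_geq // add0r; congr (_ + _); apply: eq_bigr => l _.
by rewrite subSn ?(ltnW (ltn_ord l)) // seriesSr mulrDr.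
Qed.

Lemma series_mulB_cauchy_prod a b k :
  series a k * series b k - series (cauchy_prod a b) k =
  \sum_(l < k) \sum_(k - l <= j < k) a l * b j.
Proof.
rewrite series_cauchy_prod {1}/series /= big_mkord mulr_suml -sumrB.
apply: eq_bigr => l _; rewrite -mulrBr -mulr_sumr; congr (_ * _).
by rewrite sub_series_geq ?leq_subr.
Qed.

Lemma series_ge0_le a j k :
  (forall i, 0 <= a i) -> (j <= k)%N -> series a j <= series a k.
Proof.
by move=> a0 jk; rewrite -subr_ge0 sub_series_geq // sumr_ge0.
Qed.

Lemma cvg_cauchy_prod_ge0 a b :
  (forall i, 0 <= a i) -> (forall i, 0 <= b i) ->
  cvgn (series a) -> cvgn (series b) ->
  series a k * series b k - series (cauchy_prod a b) k @[k --> \oo] --> 0.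
Proof.
move=> a0 b0 ca cb.
set D := fun k => _.
have s0 (c : R^nat) k : (forall i, 0 <= c i) -> 0 <= series c k.
  by move=> c0; rewrite /series /= sumr_ge0.
have D0 k : 0 <= D k.
  by rewrite /D series_mulB_cauchy_prod; do 2 apply: sumr_ge0 => ? _; rewrite mulr_ge0.
(* The Cauchy product up to k contains the square [0, k/2) x [0, k/2). *)
have DE k : D k <= series a k * series b k - series a k./2 * series b k./2.
  rewrite lerD2l lerN2 series_cauchy_prod.
  apply: (@le_trans _ _ (\sum_(l < k./2) a l * series b (k - l)%N)).
    rewrite {1}/series /= big_mkord mulr_suml; apply: ler_sum => l _.
    rewrite ler_wpM2l //; apply: series_ge0_le => //.
    by have := ltn_ord l; lia.
  rewrite -!(big_mkord xpredT (fun l => a l * series b (k - l)%N)).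
  rewrite [leRHS](@big_cat_nat _ _ _ k./2) //=; last by lia.
  by rewrite lerDl; apply: sumr_ge0 => l _; rewrite mulr_ge0 // s0.
have half : k./2 @[k --> \oo] --> \oo.
  move=> A [N _ NA]; exists (N.*2) => // k /= Nk; apply: NA => /=; lia.
apply: (@squeeze_cvgr _ _ _ _ (cst 0)
    (fun k => series a k * series b k - series a k./2 * series b k./2)).
- by apply: nearW => k; rewrite D0 DE.
- exact: cvg_cst.
- rewrite -(subrr (limn (series a) * limn (series b))).
  apply: cvgB; first exact: cvgM.
  by apply: cvgM; [exact: (cvg_comp _ _ half ca)|exact: (cvg_comp _ _ half cb)].
Qed.

Lemma cvg_cauchy_prod a b :
  cvgn [normed series a] -> cvgn [normed series b] ->
  series (cauchy_prod a b) k @[k --> \oo] --> limn (series a) * limn (series b).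
Proof.
move=> na nb.
have D0 : series a k * series b k - series (cauchy_prod a b) k @[k --> \oo] --> 0.
  apply/norm_cvg0P.
  have N0 := cvg_cauchy_prod_ge0 (fun i => normr_ge0 (a i)) (fun i => normr_ge0 (b i)) na nb.
  apply: (squeeze_cvgr _ (cvg_cst 0) N0).
  apply: nearW => k; rewrite normr_ge0 /= !series_mulB_cauchy_prod.
  apply: le_trans (ler_norm_sum _ _ _) _; apply: ler_sum => l _.
  apply: le_trans (ler_norm_sum _ _ _) _; apply: ler_sum => j _.
  by rewrite normrM.
rewrite -[_ * _]subr0.
apply: cvg_trans (cvgB (cvgM (normed_cvg na) (normed_cvg nb)) D0).
apply: near_eq_cvg; apply: nearW => k.
by rewrite -[LHS]/(series a k * series b k -
  (series a k * series b k - series (cauchy_prod a b) k)) subKr.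
Qed.

End CauchyProduct.

Section Summation.
Context {R : realType}.

Lemma cvgn_linear n q (L : 'M[R]_n -> 'M[R]_q) (U : nat -> 'M[R]_n) X :
  linear L -> U k @[k --> \oo] --> X -> L (U k) @[k --> \oo] --> L X.
Proof.
move=> linL UX; apply: cvgn_mx => c d; rewrite (linear_mxE _ _ _ linL).
under eq_cvg do rewrite (linear_mxE _ _ _ linL).
apply: cvg_big => [|ij _]; first exact: add_continuous.
by apply: cvgMr; exact: cvgn_coord.
Qed.

Lemma series_coord n (u : nat -> 'M[R]_n) k a b :
  series u k a b = series (fun i => u i a b) k.
Proof. by rewrite /series /= summxE. Qed.

Lemma limn_series_coord n (u : nat -> 'M[R]_n) a b :
  cvgn (series u) ->
  limn (series u) a b = limn (series (fun i => u i a b)) /\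
  cvgn (series (fun i => u i a b)).
Proof.
move=> cu; have := cvgn_coord (i := a) (j := b) cu.
under eq_cvg do rewrite series_coord.
by move=> cab; split; [apply/esym/cvg_lim|apply/cvg_ex; eexists; exact: cab].
Qed.

Lemma gram_coef_ge0 r (X : colmx R r) a b (e : R) :
  0 <= gram X a a + e ^+ 2 * gram X b b + 2 * e * gram X a b.
Proof.
have gE i j : gram X i j = \sum_c tagged X i c * tagged X j c.
  by rewrite mxE; apply: eq_bigr => c _; rewrite mxE.
suff -> : gram X a a + e ^+ 2 * gram X b b + 2 * e * gram X a b =
    \sum_c (tagged X a c + e * tagged X b c) ^+ 2.
  by apply: sumr_ge0 => c _; rewrite sqr_ge0.
rewrite !gE !mulr_sumr -!big_split; apply: eq_bigr => c _ /=; ring.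
Qed.

(* Off-diagonal entries are dominated by the diagonal, by positivity. *)
Lemma norm_gramian_coef n k (K : seq R -> colmx R n) X a b :
  has_iterated_integral k (fun t => gram (K t)) X ->
  `|X a b| <= X a a + X b b.
Proof.
move=> KX.
pose L e (Y : 'M[R]_n) : 'M[R]_1 := (Y a a + e ^+ 2 * Y b b + 2 * e * Y a b)%:M.
have linL e : linear (L e).
  by move=> c Y Z; apply/matrixP => i j; rewrite !ord1 !mxE !eqxx; ring.
have L0 e : 0 <= X a a + e ^+ 2 * X b b + 2 * e * X a b.
  have L0 t : 0 <= L e (gram (K t)) 0 0 by rewrite mxE eqxx gram_coef_ge0.
  have := has_iterated_integral_ge0 L0 (has_iterated_integral_linear (linL e) KX).
  by rewrite mxE eqxx.
have := L0 1; have := L0 (- 1).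
have [Xab|Xab] := leP 0 (X a b).
  by rewrite !expr2 ger0_norm //; lra.
by rewrite !expr2 ltr0_norm //; lra.
Qed.

Lemma normed_cvg_gramian_coef n (K : kernels R n) (u : nat -> 'M[R]_n) a b :
  (forall i, has_iterated_integral i.+1 (fun t => gram (K i.+1 t)) (u i)) ->
  cvgn (series u) -> cvgn [normed series (fun i => u i a b)].
Proof.
move=> Ku cu.
have ca c : cvgn (series (fun i => u i c c)) by case: (limn_series_coord c c cu).
apply: (@series_le_cvg _ _ (fun i => u i a a + u i b b)).
- by move=> i /=.
- by move=> i; apply: le_trans (norm_gramian_coef a b (Ku i)).
- by move=> i; exact: norm_gramian_coef (Ku i).
- exact: is_cvg_seriesD.
Qed.

Lemma cvg_tens_cauchy n (p q : nat -> 'M[R]_n) :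
  cvgn (series p) -> cvgn (series q) ->
  (forall a b, cvgn [normed series (fun i => p i a b)]) ->
  (forall a b, cvgn [normed series (fun i => q i a b)]) ->
  series (fun i => \sum_(l < i) p l *t q (i.-1 - l)%N) k @[k --> \oo] -->
    limn (series p) *t limn (series q).
Proof.
move=> cp cq np nq; apply: cvgn_mx => a b.
case: (mxtens_indexP a) => a1 a2; case: (mxtens_indexP b) => b1 b2.
rewrite tensmxE (limn_series_coord _ _ cp).1 (limn_series_coord _ _ cq).1.
rewrite -cvg_shiftS; apply: cvg_trans (cvg_cauchy_prod (np a1 b1) (nq a2 b2)).
apply: near_eq_cvg; apply: nearW => k.
rewrite /= series_coord /series /= big_nat_recl // big_ord0 mxE add0r.
apply: eq_bigr => i _; rewrite summxE /cauchy_prod.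
by apply: eq_bigr => l _; rewrite tensmxE.
Qed.

Lemma lyapunov_series n q (A D : 'M[R]_n) (H : 'M[R]_(n, q)) m (N : 'I_m -> 'M[R]_n)
    (k : nat -> 'M[R]_n) (c : nat -> 'M[R]_q) K C :
  A *m k 0%N + k 0%N *m A^T + D = 0 ->
  (forall i, A *m k i.+1 + k i.+1 *m A^T
     + (H *m c i *m H^T + \sum_j N j *m k i *m (N j)^T) = 0) ->
  series k i @[i --> \oo] --> K -> series c i @[i --> \oo] --> C ->
  A *m K + K *m A^T + (H *m C *m H^T + \sum_j N j *m K *m (N j)^T) + D = 0.
Proof.
move=> k0 kS cK cC.
pose L1 (X : 'M[R]_n) := A *m X + X *m A^T.
pose L2 (X : 'M[R]_q) := H *m X *m H^T.
pose L3 (X : 'M[R]_n) := \sum_j N j *m X *m (N j)^T.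
have lin1 : linear L1 := lyapunov_linear A.
have lin2 : linear L2 by exact: mulmx_lr_linear.
have lin3 : linear L3.
  move=> a X Y; rewrite /L3 scaler_sumr -big_split; apply: eq_bigr => j _ /=.
  exact: mulmx_lr_linear.
have D1 X Y : L1 (X + Y) = L1 X + L1 Y by have := lin1 1 X Y; rewrite !scale1r.
have D2 X Y : L2 (X + Y) = L2 X + L2 Y by have := lin2 1 X Y; rewrite !scale1r.
have D3 X Y : L3 (X + Y) = L3 X + L3 Y by have := lin3 1 X Y; rewrite !scale1r.
have E i : L1 (series k i.+1) + (L2 (series c i) + L3 (series k i)) + D = 0.
  elim: i => [|i IH].
    rewrite seriesSr ![series _ 0%N]big_geq // add0r /L2 mulmx0 mul0mx.
    rewrite /L3 big1 ?addr0 // => j _.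
    by rewrite mulmx0 mul0mx.
  rewrite seriesSr [series c _]seriesSr [X in L3 X]seriesSr D1 D2 D3.
  have := kS i; rewrite -/(L1 _) -/(L2 _) -/(L3 _) => kSi.
  by rewrite (addrACA (L2 _)) (addrACA (L1 _)) kSi addr0.
have cK1 : series k i.+1 @[i --> \oo] --> K by rewrite (cvg_shiftS (series k)).
have cL : L1 (series k i.+1) + (L2 (series c i) + L3 (series k i)) + D @[i --> \oo]
    --> L1 K + (L2 C + L3 K) + D.
  apply: cvgD; last exact: cvg_cst.
  apply: cvgD; first exact: cvgn_linear cK1.
  by apply: cvgD; exact: cvgn_linear.
rewrite -/(L1 K) -/(L2 C) -/(L3 K).
apply: (cvg_unique _ cL); first exact: norm_hausdorff.
by apply: cvg_near_cst; apply: nearW => i; exact: E.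
Qed.

End Summation.

Theorem theorem3p2 (R : realType) (n m p : nat)
    (A : 'M[R]_n) (H : 'M[R]_(n, n * n)) (N : 'I_m -> 'M[R]_n)
    (B : 'M[R]_(n, m)) (C : 'M[R]_(p, n)) :
  stable A ->
  hessian_symmetric H ->
  gramian_exists (Pbar A H N B) ->
  gramian_exists (Qbar A H N B C) ->
  let P := gramian (Pbar A H N B) in
  let Q := gramian (Qbar A H N B C) in
  A^T *m Q + Q *m A + mode2 H *m (P *t Q) *m (mode2 H)^T
    + \sum_(k < m) (N k)^T *m Q *m N k + C^T *m C = 0.
Proof.
move=> _ _ [IP cP] [IQ cQ] P Q.
have hP i : has_iterated_integral i.+1 (fun t => gram (Pbar A H N B i.+1 t))
    (gramian_term (Pbar A H N B) i.+1) by split=> //; exact: IP.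
have hQ i : has_iterated_integral i.+1 (fun t => gram (Qbar A H N B C i.+1 t))
    (gramian_term (Qbar A H N B C) i.+1) by split=> //; exact: IQ.
have KE i (i0 : (0 < i)%N) := QbarE A H N B C i0.
have nP a b := @normed_cvg_gramian_coef _ _ _ _ a b hP cP.
have nQ a b := @normed_cvg_gramian_coef _ _ _ _ a b hQ cQ.
have := lyapunov_series (lyapunov_kernel1 KE hQ) (lyapunov_kernelSS KE hP hQ)
  cQ (cvg_tens_cauchy cP cQ nP nQ).
rewrite !trmxK addrA => E; rewrite -[RHS]E; congr (_ + _ + _).
by apply: eq_bigr => k _; rewrite trmxK.
Qed.
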